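(* Let $q\in\mathbb{C}$ with $|q|<1$, and let $a,b,c,d,\alpha$ be complex numbers with $|a|<1$ and $|c|<1$. Then $$\sum_{n=0}^{\infty}\frac{(b/a)_n a^n}{(1-cq^n)^{\alpha}(d)_n}=\sum_{j=0}^{\infty}c^j \binom{\alpha + j -1}{j}\sum_{n=0}^{\infty}\frac{(ad/b)_n(-b)^nq^{\binom{n}{2}+jn}}{(d)_n(aq^j)_{n+1}}.$$
   Context: For $x\in\mathbb{C}$: $(x)_0=1$, $(x)_n=(1-x)(1-xq)\cdots(1-xq^{n-1})$ for $n\ge1$, $(x)_\infty=\lim_{n\to\infty}(x)_n$. For complex $\alpha$ and a nonnegative integer $n$, the binomial coefficient is $\binom{\alpha}{n}=\frac{\Gamma(\alpha+1)}{\Gamma(n+1)\Gamma(\alpha-n+1)}$, i.e. the generalized binomial coefficient $\alpha(\alpha-1)\cdots(\alpha-n+1)/n!$, so that $(1-z)^{-\alpha}=\sum_{j\ge0}\binom{\alpha+j-1}{j}z^j$ for $|z|<1$ (principal branch). *)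

(* Defs.v *)
From Stdlib Require Import Reals Factorial.
From Coquelicot Require Import Coquelicot.

Open Scope C_scope.

(* (x)_n = (1 - x) (1 - x q) ... (1 - x q^(n-1)) *)
Fixpoint qpoch (q x : C) (n : nat) : C :=
  match n with
  | O => 1
  | S m => qpoch q x m * (1 - x * q ^ m)
  end.

(* z (z - 1) ... (z - n + 1) *)
Fixpoint falling (z : C) (n : nat) : C :=
  match n with
  | O => 1
  | S m => falling z m * (z - INR m)
  end.

Definition gbinom (z : C) (n : nat) : C := falling z n / INR (fact n).

Definition Cexp (z : C) : C :=
  (exp (fst z) * cos (snd z), exp (fst z) * sin (snd z))%R.

(* Principal argument, with values in (-PI, PI]; irrelevant value at 0. *)
Definition Carg (z : C) : R :=
  if Rle_dec 0 (snd z) then acos (fst z / Cmod z) else (- acos (fst z / Cmod z))%R.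

Definition Cln (z : C) : C := (ln (Cmod z), Carg z).

(* Principal branch of z^w, meaningful for z <> 0 only. *)
Definition Cpower (z w : C) : C := Cexp (w * Cln z).

(* Main.v *)
(* Write F(d,t) = sum_n (beta)_n t^n / (d)_n with beta = b/a. Comparing coefficients,
     (1 - t) F(d,t) = 1 + (d - beta) t / (1 - d) F(dq, tq),
   and iterating this produces the partial sums of the inner series on the right-hand
   side (with t = a q^j); the remainder dies like q^(N choose 2). Expanding
   (1 - c q^n)^(-alpha) by the binomial series on the left and exchanging the two
   absolutely convergent sums yields sum_j c^j binom(alpha+j-1, j) F(d, a q^j). *)
Require Import Defs.
From Stdlib Require Import Reals Lra Lia Factorial.
From Coquelicot Require Import Coquelicot.

Open Scope C_scope.

(** * Complex series *)

(** The parameter [d] may be large; all that is known of the denominators is that they do not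
    vanish. Convergence of infinite products is avoided: it suffices that a shifted factorial, and
    its inverse when it never vanishes, is O(rho^n) for every [rho > 1]. Such a loss is absorbed by
    [t ^ n] when [rho] is close enough to 1, and by the Gaussian power of [q] in the remainder of
    the iteration, whatever the size of [rho]. The exchange of sums stays elementary because
    [q ^ (j * n)] is the only factor that couples the two indices and its modulus is at most 1, so
    the double family is dominated by a product of two geometric sequences. The binomial series with
    complex exponent is reduced to real calculus along the segment from 1 to [1 - z], where the
    principal logarithm has smooth real components. *)

Lemma is_series_Re (f : nat -> C) (s : C) :
  is_series f s -> is_series (fun n => Re (f n)) (Re s).
Proof.
  intros H. unfold is_series in *.
  apply filterlim_ext with (fun n => Re (sum_n f n)).
  - intros n. induction n as [|n IH]; [now rewrite !sum_O|].
    rewrite !sum_Sn, <- IH. reflexivity.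
  - apply filterlim_comp with (2 := continuous_fst (fst s) (snd s)).
    now destruct s.
Qed.

Lemma is_series_Im (f : nat -> C) (s : C) :
  is_series f s -> is_series (fun n => Im (f n)) (Im s).
Proof.
  intros H. unfold is_series in *.
  apply filterlim_ext with (fun n => Im (sum_n f n)).
  - intros n. induction n as [|n IH]; [now rewrite !sum_O|].
    rewrite !sum_Sn, <- IH. reflexivity.
  - apply filterlim_comp with (2 := continuous_snd (fst s) (snd s)).
    now destruct s.
Qed.

Lemma is_series_Re_Im (f : nat -> C) (s : C) :
  is_series (fun n => Re (f n)) (Re s) -> is_series (fun n => Im (f n)) (Im s) ->
  is_series f s.
Proof.
  intros Hr Hi. unfold is_series in *.
  apply (proj2 (filterlim_locally (F := eventually) (sum_n f) s)). intros eps.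
  generalize (filter_and _ _ (proj1 (filterlim_locally _ _) Hr eps)
                (proj1 (filterlim_locally _ _) Hi eps)).
  apply filter_imp. intros n [H1 H2].
  assert (E : sum_n f n = (sum_n (fun n => Re (f n)) n, sum_n (fun n => Im (f n)) n)).
  { clear. induction n as [|n IH]; [rewrite !sum_O; now destruct (f O)|].
    rewrite !sum_Sn, IH. reflexivity. }
  rewrite E. now split.
Qed.

(** A total function, so that a family of sums such as [fun N => Cseries (f N)] can be formed
    without choosing witnesses of convergence. *)
Definition Cseries (f : nat -> C) : C :=
  (Series (fun n => Re (f n)), Series (fun n => Im (f n))).

Lemma is_series_Cseries (f : nat -> C) (b : nat -> R) :
  (forall n, (Cmod (f n) <= b n)%R) -> ex_series b -> is_series f (Cseries f).
Proof.
  intros Hf Hb.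
  destruct (ex_series_le (K := C_AbsRing) (V := C_CompleteNormedModule) f b) as [s Hs]; auto.
  apply is_series_Re_Im; apply Series_correct; eexists.
  - apply is_series_Re, Hs.
  - apply is_series_Im, Hs.
Qed.

Lemma is_series_C_unique (f : nat -> C) (s s' : C) :
  is_series f s -> is_series f s' -> s = s'.
Proof. apply (filterlim_locally_unique (F := eventually) (sum_n f)). Qed.

Lemma is_series_of_bound (f : nat -> C) (s : C) (e : nat -> R) :
  (forall n, (Cmod (sum_n f n - s) <= e n)%R) -> is_lim_seq e 0 -> is_series f s.
Proof.
  intros He Hl. unfold is_series.
  apply (proj2 (filterlim_locally_ball_norm (K := C_AbsRing) (U := C_NormedModule)
                  (F := eventually) (sum_n f) s)).
  intros eps. apply is_lim_seq_spec in Hl. generalize (Hl eps).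
  apply filter_imp. intros n Hn.
  apply Rle_lt_trans with (1 := He n).
  apply Rle_lt_trans with (2 := Hn). rewrite Rminus_0_r. apply Rle_abs.
Qed.

Lemma Cmod_sum_n (f : nat -> C) (b : nat -> R) (n : nat) :
  (forall k, (Cmod (f k) <= b k)%R) -> (Cmod (sum_n f n) <= sum_n b n)%R.
Proof.
  intros H. induction n as [|n IH]; [rewrite !sum_O; apply H|].
  rewrite !sum_Sn. apply Rle_trans with (1 := Cmod_triangle _ _).
  apply Rplus_le_compat; auto.
Qed.

Lemma is_series_Cmod_le (f : nat -> C) (s : C) (b : nat -> R) (B : R) :
  is_series f s -> (forall n, (Cmod (f n) <= b n)%R) -> is_series b B -> (Cmod s <= B)%R.
Proof.
  intros Hf Hle Hb.
  assert (H1 : is_lim_seq (fun n => Cmod (sum_n f n)) (Cmod s)).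
  { unfold is_lim_seq. simpl.
    apply (filterlim_comp _ _ _ (sum_n f) Cmod eventually (locally s) (locally (Cmod s))); auto.
    apply (filterlim_norm (K := C_AbsRing) (V := C_NormedModule) s). }
  exact (is_lim_seq_le _ _ (Cmod s) B (fun n => Cmod_sum_n f b n Hle) H1 Hb).
Qed.

(* Specialized to [C] so that the resulting equations have type [C] syntactically, as
   [ring] and [field] require, instead of a projection of [C_NormedModule]. *)
Lemma is_series_Cext (f g : nat -> C) (s : C) :
  (forall n, f n = g n) -> is_series f s -> is_series g s.
Proof. apply is_series_ext. Qed.

Lemma is_series_Cplus (f g : nat -> C) (s s' : C) :
  is_series f s -> is_series g s' -> is_series (fun n => f n + g n) (s + s').
Proof. apply (is_series_plus (K := C_AbsRing) (V := C_NormedModule)). Qed.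

Lemma is_series_Cscal (k : C) (f : nat -> C) (s : C) :
  is_series f s -> is_series (fun n => k * f n) (k * s).
Proof. apply (is_series_scal (K := C_AbsRing) (V := C_NormedModule)). Qed.

Lemma is_series_Cminus (f g : nat -> C) (s s' : C) :
  is_series f s -> is_series g s' -> is_series (fun n => f n - g n) (s - s').
Proof. apply (is_series_minus (K := C_AbsRing) (V := C_NormedModule)). Qed.

Lemma plus_minus_cancel {G : AbelianGroup} (a b : G) : plus (minus a b) b = a.
Proof. unfold minus. now rewrite <- plus_assoc, plus_opp_l, plus_zero_r. Qed.

Lemma is_series_tail {K : AbsRing} {V : NormedModule K} (f : nat -> V) (s : V) (n : nat) :
  is_series f s -> is_series (fun k => f (S n + k)%nat) (minus s (sum_n f n)).
Proof.
  intros H. apply is_series_incr_n; [lia|]. simpl Nat.pred.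
  refine (eq_ind_r (is_series f) H _). exact (plus_minus_cancel (s : V) (sum_n f n)).
Qed.

Lemma is_series_Ctail1 (f : nat -> C) (s : C) :
  is_series f s -> is_series (fun n => f (S n)) (s - f O).
Proof.
  intros H. generalize (is_series_tail (K := C_AbsRing) (V := C_NormedModule) f s 0 H).
  now rewrite sum_O.
Qed.

Lemma is_series_Cof_tail1 (f : nat -> C) (s : C) :
  f O = 0 -> is_series (fun n => f (S n)) s -> is_series f s.
Proof.
  intros H0 H. apply (is_series_decr_1 (K := C_AbsRing) (V := C_NormedModule)).
  rewrite H0. refine (eq_ind_r (is_series (fun n => f (S n))) H _).
  change (s + - 0 = s). ring.
Qed.

(* The tail of the [y]-series, times the sum of the [x]-series, bounds the error of
   the partial sums of the column sums. *)
Lemma is_series_switch (f : nat -> nat -> C) (x y : nat -> R) (X : R) (r c : nat -> C) :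
  (forall n j, (Cmod (f n j) <= x n * y j)%R) ->
  (forall n, (0 <= x n)%R) ->
  is_series x X -> ex_series y ->
  (forall n, is_series (f n) (r n)) ->
  (forall j, is_series (fun n => f n j) (c j)) ->
  is_series r (Cseries r) /\ is_series c (Cseries r).
Proof.
  intros Hf Hx HX [Y HY] Hr Hc.
  assert (Sr : is_series r (Cseries r)).
  { apply is_series_Cseries with (fun n => (x n * Y)%R).
    - intros n. apply is_series_Cmod_le with (1 := Hr n) (b := fun j => (x n * y j)%R); auto.
      exact (is_series_scal (K := R_AbsRing) (V := R_NormedModule) (x n) y Y HY).
    - apply ex_series_scal_r. now exists X. }
  split; auto.
  apply is_series_of_bound with (fun J => (X * (Y - sum_n y J))%R).
  - intros J.
    assert (SJ : is_series (fun n => sum_n (f n) J) (sum_n c J)).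
    { clear - Hc. induction J as [|J IH].
      - rewrite sum_O. apply is_series_ext with (fun n => f n O); auto.
        intros n. now rewrite sum_O.
      - rewrite sum_Sn. apply is_series_ext with (fun n => sum_n (f n) J + f n (S J)).
        + intros n. now rewrite sum_Sn.
        + now apply is_series_Cplus. }
    apply is_series_Cmod_le with (1 := is_series_Cminus _ _ _ _ SJ Sr) (b := fun n => (x n * (Y - sum_n y J))%R).
    + intros n.
      replace (sum_n (f n) J - r n) with (- (r n - sum_n (f n) J)) by ring.
      rewrite Cmod_opp.
      apply is_series_Cmod_le with (f := fun k => f n (S J + k)%nat)
        (b := fun k => (x n * y (S J + k)%nat)%R).
      * apply (is_series_tail (K := C_AbsRing) (V := C_NormedModule) _ _ J (Hr n)).
      * intros k. apply Hf.
      * apply (is_series_scal (K := R_AbsRing) (V := R_NormedModule) (x n)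
                 (fun k => y (S J + k)%nat)).
        apply (is_series_tail (K := R_AbsRing) (V := R_NormedModule) _ _ J HY).
    + apply (is_series_scal_r (Y - sum_n y J) x X HX).
  - replace (Finite 0) with (Rbar_mult X (Finite (Y - Y))).
    2:{ simpl. f_equal. ring. }
    apply is_lim_seq_scal_l. apply is_lim_seq_minus'; [apply is_lim_seq_const|exact HY].
Qed.

(** * Growth bounds and the transformation of F *)

(** Source of all growth estimates below: only the limit of the ratio of consecutive terms has to be
    understood. Each uncontrolled initial term costs a division by [rho]. *)
Lemma geometric_bound (rho : R) (N : nat) (u : nat -> R) :
  (0 < rho)%R -> (forall n, (N <= n)%nat -> (u (S n) <= rho * u n)%R) ->
  exists K, (0 <= K)%R /\ forall n, (u n <= K * rho ^ n)%R.
Proof.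
  intros Hr. revert u. induction N as [|N IH]; intros u Hu.
  - exists (Rmax 0 (u O)). split; [apply Rmax_l|].
    induction n as [|n IHn].
    + simpl. rewrite Rmult_1_r. apply Rmax_r.
    + apply Rle_trans with (1 := Hu n ltac:(lia)). simpl.
      apply Rle_trans with (rho * (Rmax 0 (u O) * rho ^ n))%R; [|right; ring].
      apply Rmult_le_compat_l; lra.
  - destruct (IH (fun n => u (S n))) as [K [HK H]].
    { intros n Hn. apply Hu. lia. }
    exists (Rmax (K / rho) (u O)). split.
    { apply Rle_trans with (2 := Rmax_l _ _). apply Rdiv_le_0_compat; lra. }
    intros [|n].
    + simpl. rewrite Rmult_1_r. apply Rmax_r.
    + apply Rle_trans with (1 := H n).
      apply Rle_trans with (K / rho * rho ^ S n)%R; [right; simpl; field; lra|].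
      apply Rmult_le_compat_r; [|apply Rmax_l]. apply pow_le; lra.
Qed.

Lemma ex_series_geometric_bound (K r : R) :
  (0 <= r < 1)%R -> ex_series (fun n => (K * r ^ n)%R).
Proof.
  intros H. apply (ex_series_scal (K := R_AbsRing) (V := R_NormedModule) K).
  apply ex_series_geom. rewrite Rabs_pos_eq; lra.
Qed.

Lemma Cmod_mul_pow_small (q x : C) (eps : R) :
  (Cmod q < 1)%R -> (0 < eps)%R ->
  exists N, forall n, (N <= n)%nat -> (Cmod (x * q ^ n) < eps)%R.
Proof.
  intros Hq He.
  assert (L : is_lim_seq (fun n => (Cmod x * Cmod q ^ n)%R) (Rbar_mult (Cmod x) 0)).
  { apply is_lim_seq_scal_l, is_lim_seq_geom.
    rewrite Rabs_pos_eq; auto using Cmod_ge_0. }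
  simpl in L. rewrite Rmult_0_r in L.
  apply is_lim_seq_spec in L. destruct (L (mkposreal eps He)) as [N HN].
  exists N. intros n Hn. specialize (HN n Hn). simpl in HN.
  rewrite Cmod_mult, Cmod_pow. apply Rle_lt_trans with (2 := HN).
  rewrite Rminus_0_r. apply Rle_abs.
Qed.

(** The ratio of consecutive terms is [1 - x * q ^ n], which tends to 1 and so eventually has
    modulus at most [rho]. *)
Lemma qpoch_growth (q x : C) (rho : R) :
  (Cmod q < 1)%R -> (1 < rho)%R ->
  exists K, (0 <= K)%R /\ forall n, (Cmod (qpoch q x n) <= K * rho ^ n)%R.
Proof.
  intros Hq Hr.
  destruct (Cmod_mul_pow_small q x (rho - 1)) as [N HN]; [auto|lra|].
  apply geometric_bound with N; [lra|].
  intros n Hn. simpl. rewrite Cmod_mult, Rmult_comm.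
  apply Rmult_le_compat_r; [apply Cmod_ge_0|].
  apply Rle_trans with (1 := Cmod_triangle _ _).
  rewrite Cmod_opp, Cmod_1. specialize (HN n Hn). lra.
Qed.

Lemma Cmod_one_minus_ge (z : C) : (1 - Cmod z <= Cmod (1 - z))%R.
Proof.
  generalize (Cmod_triangle (1 - z) z).
  replace (1 - z + z) with (RtoC 1) by ring. rewrite Cmod_1. lra.
Qed.

Lemma Cmult_neq_0_inv (x y : C) : x * y <> 0 -> x <> 0 /\ y <> 0.
Proof. intros H. split; intros E; apply H; rewrite E; ring. Qed.

Lemma qpoch_inv_growth (q x : C) (rho : R) :
  (Cmod q < 1)%R -> (1 < rho)%R -> (forall n, qpoch q x n <> 0) ->
  exists K, (0 <= K)%R /\ forall n, (Cmod (/ qpoch q x n) <= K * rho ^ n)%R.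
Proof.
  intros Hq Hr Hx.
  (* With this tolerance the new factor has modulus at least [/ rho], so its inverse is at most
     [rho]. *)
  destruct (Cmod_mul_pow_small q x (1 - / rho)) as [N HN]; auto.
  { assert (/ rho < 1)%R; [|lra]. rewrite <- Rinv_1. apply Rinv_lt_contravar; lra. }
  apply geometric_bound with N; [lra|].
  intros n Hn. destruct (Cmult_neq_0_inv _ _ (Hx (S n))) as [H1 H2].
  simpl. rewrite !Cmod_inv, Cmod_mult by (auto; apply (Hx (S n))).
  assert (P1 : (0 < Cmod (qpoch q x n))%R) by now apply Cmod_gt_0.
  assert (P2 : (/ rho <= Cmod (1 - x * q ^ n))%R).
  { generalize (Cmod_one_minus_ge (x * q ^ n)) (HN n Hn). lra. }
  rewrite Rinv_mult, Rmult_comm. apply Rmult_le_compat_r.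
  - left. now apply Rinv_0_lt_compat.
  - rewrite <- (Rinv_inv rho). apply Rinv_le_contravar; auto.
    apply Rinv_0_lt_compat; lra.
Qed.

Lemma triangular_S (n : nat) : (S n * (S n - 1) / 2 = n * (n - 1) / 2 + n)%nat.
Proof.
  replace (S n * (S n - 1))%nat with (n * (n - 1) + n * 2)%nat.
  - apply Nat.div_add. lia.
  - destruct n; [reflexivity|]. rewrite !Nat.sub_succ, !Nat.sub_0_r. ring.
Qed.

(** The ratio of consecutive terms is [y * q ^ n], which tends to 0. Since [y] is arbitrary, any
    further geometric factor can be hidden in it. *)
Lemma gaussian_growth (q y : C) :
  (Cmod q < 1)%R ->
  exists K, (0 <= K)%R /\
    forall n, (Cmod (y ^ n * q ^ (n * (n - 1) / 2)) <= K * (/ 2) ^ n)%R.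
Proof.
  intros Hq.
  destruct (Cmod_mul_pow_small q y (/ 2)) as [N HN]; [auto|lra|].
  apply geometric_bound with N; [lra|].
  intros n Hn. rewrite triangular_S, Cpow_add_r, Cpow_S.
  replace (y * y ^ n * (q ^ (n * (n - 1) / 2) * q ^ n))
    with (y * q ^ n * (y ^ n * q ^ (n * (n - 1) / 2))) by ring.
  rewrite (Cmod_mult (y * q ^ n)).
  apply Rmult_le_compat_r; [apply Cmod_ge_0|].
  specialize (HN n Hn). lra.
Qed.

Lemma qpoch_S_l (q x : C) (n : nat) :
  qpoch q x (S n) = (1 - x) * qpoch q (x * q) n.
Proof.
  induction n as [|n IH]; [simpl; ring|].
  change (qpoch q x (S (S n))) with (qpoch q x (S n) * (1 - x * q ^ S n)).
  rewrite IH. simpl. ring.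
Qed.

Lemma qpoch_add (q x : C) (n m : nat) :
  qpoch q x (n + m) = qpoch q x n * qpoch q (x * q ^ n) m.
Proof.
  induction m as [|m IH]; [rewrite Nat.add_0_r; simpl; ring|].
  rewrite Nat.add_succ_r. simpl. rewrite IH, Cpow_add_r. ring.
Qed.

Lemma Cmod_mul_pow_lt (q x : C) (j : nat) :
  (Cmod q < 1)%R -> (Cmod x < 1)%R -> (Cmod (x * q ^ j) < 1)%R.
Proof.
  intros Hq Hx. apply Rle_lt_trans with (2 := Hx). rewrite Cmod_mult, Cmod_pow.
  assert (H0 := Cmod_ge_0 q). assert (H1 := Cmod_ge_0 x).
  assert (Cmod q ^ j <= 1)%R by (rewrite <- (pow1 j); apply pow_incr; lra).
  nra.
Qed.

Lemma qpoch_neq_0 (q x : C) (n : nat) :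
  (Cmod q < 1)%R -> (Cmod x < 1)%R -> qpoch q x n <> 0.
Proof.
  intros Hq Hx. induction n as [|n IH]; simpl; [apply C1_nz|].
  apply Cmult_neq_0; auto. apply Cmod_gt_0.
  apply Rlt_le_trans with (2 := Cmod_one_minus_ge _).
  generalize (Cmod_mul_pow_lt q x n Hq Hx). lra.
Qed.

(** * Fine's function and its dual expansion *)

Definition fine_term (q beta d t : C) (n : nat) : C :=
  qpoch q beta n * t ^ n / qpoch q d n.

(** Two factors [rho] are to be absorbed, one from (beta)_m and one from 1/(d)_(N+m). For rho =
    2/(1+r) the product is 4r/(1+r)^2, which is below 1 because (1-r)^2 > 0. *)
Lemma growth_rate (r : R) : (0 <= r < 1)%R ->
  exists rho, (1 < rho)%R /\ (0 <= rho * (rho * r) < 1)%R.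
Proof.
  intros Hr. exists (2 / (1 + r))%R. split; [|split].
  - apply Rmult_lt_reg_r with (1 + r)%R; [lra|].
    replace (2 / (1 + r) * (1 + r))%R with 2%R by (field; lra). lra.
  - apply Rmult_le_pos; [|apply Rmult_le_pos; [|lra]]; apply Rdiv_le_0_compat; lra.
  - apply Rmult_lt_reg_r with ((1 + r) * (1 + r))%R; [nra|].
    replace (2 / (1 + r) * (2 / (1 + r) * r) * ((1 + r) * (1 + r)))%R with (4 * r)%R
      by (field; lra).
    nra.
Qed.

(* Uniform in the shift [N], which only costs a factor [rho ^ N] after division by (d)_N. *)
Lemma fine_term_growth (q beta d t : C) :
  (Cmod q < 1)%R -> (Cmod t < 1)%R -> (forall n, qpoch q d n <> 0) ->
  exists rho K r, (1 < rho)%R /\ (0 <= K)%R /\ (0 <= r < 1)%R /\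
    forall N m,
      (Cmod (fine_term q beta (d * q ^ N) (t * q ^ N) m / qpoch q d N)
       <= K * rho ^ N * r ^ m)%R.
Proof.
  intros Hq Ht Hd.
  destruct (growth_rate (Cmod t)) as [rho [H1 H2]]; [split; auto using Cmod_ge_0|].
  destruct (qpoch_growth q beta rho Hq H1) as [K1 [P1 B1]].
  destruct (qpoch_inv_growth q d rho Hq H1 Hd) as [K2 [P2 B2]].
  exists rho, (K1 * K2)%R, (rho * (rho * Cmod t))%R.
  repeat split; try tauto. { now apply Rmult_le_pos. }
  intros N m.
  destruct (Cmult_neq_0_inv (qpoch q d N) (qpoch q (d * q ^ N) m)) as [N1 N2].
  { rewrite <- qpoch_add. apply Hd. }
  (* Since (d)_N (d q^N)_m = (d)_(N+m), one bound on the inverses of (d)_n serves every shift. *)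
  replace (fine_term q beta (d * q ^ N) (t * q ^ N) m / qpoch q d N)
    with (qpoch q beta m * t ^ m * (q ^ N) ^ m * / qpoch q d (N + m)).
  2:{ unfold fine_term. rewrite qpoch_add, Cpow_mult_l. field. auto. }
  rewrite !Cmod_mult, !Cmod_pow.
  assert (L : ((Cmod q ^ N) ^ m <= 1)%R).
  { rewrite <- pow_mult, <- (pow1 (N * m)). apply pow_incr.
    split; [apply Cmod_ge_0|lra]. }
  assert (L0 : (0 <= (Cmod q ^ N) ^ m)%R) by (do 2 apply pow_le; apply Cmod_ge_0).
  assert (T0 : (0 <= Cmod t ^ m)%R) by (apply pow_le, Cmod_ge_0).
  apply Rle_trans with (K1 * rho ^ m * Cmod t ^ m * 1 * (K2 * rho ^ (N + m)))%R.
  - apply Rmult_le_compat; auto using Cmod_ge_0.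
    + repeat apply Rmult_le_pos; auto using Cmod_ge_0.
    + apply Rmult_le_compat; auto.
      * repeat apply Rmult_le_pos; auto using Cmod_ge_0.
      * apply Rmult_le_compat_r; auto.
  - right. rewrite pow_add, !Rpow_mult_distr. ring.
Qed.

(** The difference (beta)_(n+1)/(d)_(n+1) - (beta)_n/(d)_n equals (d - beta) q^n (beta)_n /
    (d)_(n+1), and (d)_(n+1) = (1 - d) (dq)_n: the coefficients of (1 - t) F(d,t) beyond the
    constant term are again of the same type. *)
Lemma fine_functional_equation (q beta d t s s' : C) :
  (forall n, qpoch q d n <> 0) ->
  is_series (fine_term q beta d t) s ->
  is_series (fine_term q beta (d * q) (t * q)) s' ->
  (1 - t) * s = 1 + (d - beta) * t / (1 - d) * s'.
Proof.
  intros Hd Hs Hs'.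
  assert (D := is_series_Cminus _ _ _ _ (is_series_Ctail1 _ _ Hs) (is_series_Cscal t _ _ Hs)).
  assert (D' : is_series (fun n => fine_term q beta d t (S n) - t * fine_term q beta d t n)
    ((d - beta) * t / (1 - d) * s')).
  { eapply is_series_Cext; [|apply is_series_Cscal, Hs'].
    intros n. cbv beta.
    generalize (Hd (S n)) (Hd n); intros A1 A2.
    assert (A3 := A1). rewrite qpoch_S_l in A3.
    destruct (Cmult_neq_0_inv _ _ A3) as [N1 N2].
    destruct (Cmult_neq_0_inv _ _ A1) as [N3 N4].
    assert (E : qpoch q (d * q) n = qpoch q d n * (1 - d * q ^ n) / (1 - d)).
    { generalize (qpoch_S_l q d n); simpl; intros ->. now field. }
    unfold fine_term. rewrite E, Cpow_mult_l, Cpow_S. simpl qpoch. field. repeat split; auto. }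
  generalize (is_series_C_unique _ _ _ D D'). intros E.
  rewrite <- E. unfold fine_term; simpl. field.
Qed.

(** The index [n + 1] at [t] counts one more division than at [d]: the constant 1 of the equation at
    stage n is still divided by 1 - t q^n. *)
Definition fine_dual_term (q beta d t : C) (n : nat) : C :=
  qpoch q (d / beta) n * (- (beta * t)) ^ n * q ^ (n * (n - 1) / 2)
  / (qpoch q d n * qpoch q t (n + 1)).

Lemma fine_transformation (q beta d t s : C) :
  (Cmod q < 1)%R -> (Cmod t < 1)%R -> beta <> 0 -> (forall n, qpoch q d n <> 0) ->
  is_series (fine_term q beta d t) s -> is_series (fine_dual_term q beta d t) s.
Proof.
  intros Hq Ht Hb Hd Hs.
  destruct (fine_term_growth q beta d t Hq Ht Hd) as (rho & K & r & Hrho & HK & Hr & HG).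
  assert (Hd' : forall N n, qpoch q (d * q ^ N) n <> 0).
  { intros N n. apply (Cmult_neq_0_inv (qpoch q d N)). rewrite <- qpoch_add. apply Hd. }
  assert (Ht' : forall n, qpoch q t n <> 0) by (intros n; now apply qpoch_neq_0).
  destruct (qpoch_growth q (d / beta) rho Hq Hrho) as [K1 [P1 B1]].
  destruct (qpoch_inv_growth q t rho Hq Hrho Ht') as [K2 [P2 B2]].
  (* The three factors [rho] pay for the growth of (d/beta)_N, of 1/(t)_N, and of [F N] divided by
     (d)_N. *)
  destruct (gaussian_growth q (- (beta * t) * RtoC (rho * (rho * rho))) Hq) as [K3 [P3 B3]].
  (* Taking -beta out of each factor d q^k - beta with k < N leaves (d/beta)_N, and the factors t
     q^k give the triangular power of q. The accompanying 1/(d)_N is kept apart, because it is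
     estimated together with [F N]. *)
  set (A := fun N => qpoch q (d / beta) N * (- (beta * t)) ^ N * q ^ (N * (N - 1) / 2)
                     * / qpoch q t N).
  assert (Ser : forall N, is_series (fine_term q beta (d * q ^ N) (t * q ^ N))
                  (Cseries (fine_term q beta (d * q ^ N) (t * q ^ N)))).
  { intros N.
    apply is_series_Cseries with (fun m => (Cmod (qpoch q d N) * (K * rho ^ N) * r ^ m)%R).
    2: now apply ex_series_geometric_bound.
    intros m. rewrite Rmult_assoc.
    replace (fine_term q beta (d * q ^ N) (t * q ^ N) m) with
      (qpoch q d N * (fine_term q beta (d * q ^ N) (t * q ^ N) m / qpoch q d N))
      by (field; apply Hd).
    rewrite Cmod_mult. apply Rmult_le_compat_l; auto using Cmod_ge_0. }
  set (F := fun N => Cseries (fine_term q beta (d * q ^ N) (t * q ^ N))) in *.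
  assert (St : forall N, (1 - t * q ^ N) * F N =
    1 + (d * q ^ N - beta) * (t * q ^ N) / (1 - d * q ^ N) * F (S N)).
  { intros N. apply fine_functional_equation with q.
    - apply Hd'.
    - apply Ser.
    - replace (d * q ^ N * q) with (d * q ^ S N) by (rewrite Cpow_S; ring).
      replace (t * q ^ N * q) with (t * q ^ S N) by (rewrite Cpow_S; ring).
      apply (Ser (S N)). }
  (* One step of the telescoping: the constant 1 in [St] produces the dual term, the rest is the
     next remainder. *)
  assert (St' : forall N, A N / qpoch q d N * F N =
     fine_dual_term q beta d t N + A (S N) / qpoch q d (S N) * F (S N)).
  { intros N. unfold A, fine_dual_term. rewrite triangular_S, Cpow_add_r, Cpow_S.
    rewrite Nat.add_1_r. simpl qpoch.
    destruct (Cmult_neq_0_inv _ _ (Hd (S N))) as [N1 N2].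
    destruct (Cmult_neq_0_inv _ _ (Ht' (S N))) as [N3 N4].
    replace (F N) with ((1 + (d * q ^ N - beta) * (t * q ^ N) / (1 - d * q ^ N) * F (S N))
                        / (1 - t * q ^ N)) by (rewrite <- St; now field).
    field. repeat split; auto. }
  assert (Id : forall N, s = sum_n (fine_dual_term q beta d t) N
                             + A (S N) / qpoch q d (S N) * F (S N)).
  { induction N as [|N IH].
    - rewrite sum_O, <- St'. unfold A, F; simpl.
      replace (1 * 1 * 1 * / 1 / 1) with (RtoC 1) by (field).
      rewrite Cmult_1_l. apply is_series_C_unique with (1 := Hs).
      generalize (Ser O). unfold F. simpl. now rewrite !Cmult_1_r.
    - rewrite sum_Sn, IH, St'. unfold plus; simpl. ring. }
  apply is_series_of_bound with (fun N => (K1 * K2 * K3 * K / (1 - r) * (/ 2) ^ S N)%R).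
  - intros N. rewrite (Id N) at 1.
    replace (sum_n (fine_dual_term q beta d t) N -
      (sum_n (fine_dual_term q beta d t) N + A (S N) / qpoch q d (S N) * F (S N)))
      with (- (A (S N) * (F (S N) / qpoch q d (S N)))) by (field; apply Hd).
    rewrite Cmod_opp, Cmod_mult. generalize (S N); clear N; intros N.
    assert (BF : (Cmod (F N / qpoch q d N) <= K * rho ^ N * / (1 - r))%R).
    { apply is_series_Cmod_le with
        (f := fun m => / qpoch q d N * fine_term q beta (d * q ^ N) (t * q ^ N) m)
        (b := fun m => (K * rho ^ N * r ^ m)%R).
      - replace (F N / qpoch q d N) with (/ qpoch q d N * F N) by (unfold Cdiv; ring).
        apply is_series_Cscal, Ser.
      - intros m. rewrite Cmult_comm. apply HG.
      - apply (is_series_scal (K := R_AbsRing) (V := R_NormedModule) (K * rho ^ N)%R).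
        apply is_series_geom. rewrite Rabs_pos_eq; lra. }
    assert (Rp : forall n, (0 < rho ^ n)%R) by (intros n; apply pow_lt; lra).
    assert (BA : (Cmod (A N) * (rho ^ N) <= K1 * K2 * K3 * (/ 2) ^ N)%R).
    { specialize (B3 N). rewrite Cpow_mult_l, !Cmod_mult, Cmod_pow, <- RtoC_pow, Cmod_R in B3.
      rewrite Rabs_pos_eq in B3 by (apply pow_le; nra).
      rewrite !Rpow_mult_distr in B3.
      unfold A. rewrite !Cmod_mult, Cmod_pow.
      set (y := (Cmod (- (beta * t)) ^ N)%R) in *.
      assert (0 <= y)%R by (apply pow_le, Cmod_ge_0).
      set (g := Cmod (q ^ (N * (N - 1) / 2))) in *.
      assert (0 <= g)%R by apply Cmod_ge_0.
      apply Rle_trans with ((K1 * rho ^ N) * y * g * (K2 * rho ^ N) * rho ^ N)%R.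
      - apply Rmult_le_compat_r; [left; apply Rp|].
        apply Rmult_le_compat; auto using Cmod_ge_0.
        + repeat apply Rmult_le_pos; auto using Cmod_ge_0.
        + do 2 (apply Rmult_le_compat_r; auto).
      - replace (K1 * rho ^ N * y * g * (K2 * rho ^ N) * rho ^ N)%R with
          (K1 * K2 * (y * (rho ^ N * (rho ^ N * rho ^ N)) * g))%R by ring.
        rewrite (Rmult_assoc (K1 * K2)). apply Rmult_le_compat_l; auto.
        now apply Rmult_le_pos. }
    apply Rle_trans with (Cmod (A N) * (K * rho ^ N * / (1 - r)))%R.
    { apply Rmult_le_compat_l; auto using Cmod_ge_0. }
    assert (0 <= K * / (1 - r))%R.
    { apply Rmult_le_pos; auto. left; apply Rinv_0_lt_compat; lra. }
    replace (Cmod (A N) * (K * rho ^ N * / (1 - r)))%R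
      with (Cmod (A N) * rho ^ N * (K * / (1 - r)))%R by ring.
    replace (K1 * K2 * K3 * K / (1 - r) * (/ 2) ^ N)%R
      with (K1 * K2 * K3 * (/ 2) ^ N * (K * / (1 - r)))%R by (unfold Rdiv; ring).
    now apply Rmult_le_compat_r.
  - set (M := (K1 * K2 * K3 * K / (1 - r))%R).
    apply (is_lim_seq_incr_1 (fun n => (M * (/ 2) ^ n)%R)).
    replace (Finite 0) with (Rbar_mult M 0) by (simpl; f_equal; ring).
    apply is_lim_seq_scal_l, is_lim_seq_geom. rewrite Rabs_pos_eq; lra.
Qed.

(** * The binomial series *)

Lemma falling_S_l (z : C) (n : nat) : falling (z + 1) (S n) = (z + 1) * falling z n.
Proof.
  induction n as [|n IH]; [simpl; ring|].
  change (falling (z + 1) (S (S n))) with (falling (z + 1) (S n) * (z + 1 - INR (S n))).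
  rewrite IH, S_INR, RtoC_plus. simpl. ring.
Qed.

Lemma RtoC_neq_0 (x : R) : (x <> 0)%R -> RtoC x <> 0.
Proof. intros H E. apply H. now apply RtoC_inj. Qed.

(** The upper argument moves with [j], so the new factor [alpha + j] enters at the top of the
    falling factorial. This recursion gives both the growth of the coefficients and the differential
    equation of the series. *)
Lemma gbinom_step (alpha : C) (j : nat) :
  RtoC (INR (S j)) * gbinom (alpha + INR (S j) - 1) (S j)
  = (alpha + INR j) * gbinom (alpha + INR j - 1) j.
Proof.
  unfold gbinom.
  replace (alpha + INR (S j) - 1) with (alpha + INR j - 1 + 1)
    by (rewrite S_INR, RtoC_plus; ring).
  rewrite falling_S_l. change (fact (S j)) with (S j * fact j)%nat.
  rewrite mult_INR, RtoC_mult.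
  replace (alpha + INR j - 1 + 1) with (alpha + INR j) by ring.
  field. split; apply RtoC_neq_0; [apply INR_fact_neq_0|now apply not_0_INR].
Qed.

Lemma gbinom_growth (alpha z : C) :
  (Cmod z < 1)%R ->
  exists K r, (0 <= K)%R /\ (0 < r < 1)%R /\
    forall j, (Cmod (gbinom (alpha + INR j - 1) j * z ^ j) <= K * r ^ j)%R.
Proof.
  intros Hz. set (r := ((1 + Cmod z) / 2)%R).
  assert (Hm := Cmod_ge_0 z). assert (Ha := Cmod_ge_0 alpha).
  (* Beyond this index |alpha| <= (r - |z|) n, hence (|alpha| + n) |z| <= |alpha| + n |z| <= r n <=
     r (n + 1), which bounds the ratio by [r], the midpoint of |z| and 1. *)
  destruct (nfloor_ex (Cmod alpha / (r - Cmod z))) as [N [_ HN]].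
  { apply Rdiv_le_0_compat; unfold r; lra. }
  destruct (geometric_bound r (S N)
    (fun j => Cmod (gbinom (alpha + INR j - 1) j * z ^ j))) as [K [HK H]].
  { unfold r; lra. }
  2:{ exists K, r. repeat split; auto; unfold r; lra. }
  intros n Hn.
  assert (Hpos : (0 < INR (S n))%R) by (apply lt_0_INR; lia).
  assert (Hnz : RtoC (INR (S n)) <> 0) by (apply RtoC_neq_0; lra).
  replace (gbinom (alpha + INR (S n) - 1) (S n) * z ^ S n) with
    ((alpha + INR n) / INR (S n) * z * (gbinom (alpha + INR n - 1) n * z ^ n)).
  2:{ replace (gbinom (alpha + INR (S n) - 1) (S n)) with
       ((alpha + INR n) * gbinom (alpha + INR n - 1) n / INR (S n)).
      - rewrite Cpow_S. now field.
      - rewrite <- gbinom_step. now field. }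
  rewrite (Cmod_mult (_ * z)).
  apply Rmult_le_compat_r; [apply Cmod_ge_0|].
  rewrite Cmod_mult, Cmod_div, (Cmod_R (INR (S n))), (Rabs_pos_eq (INR (S n))) by (auto; lra).
  apply Rmult_le_reg_r with (INR (S n)); auto.
  replace (Cmod (alpha + INR n) / INR (S n) * Cmod z * INR (S n))%R
    with (Cmod (alpha + INR n) * Cmod z)%R by (field; lra).
  assert (HI : (INR N + 1 <= INR n)%R) by (rewrite <- S_INR; apply le_INR; lia).
  assert (H1 : (Cmod alpha <= (r - Cmod z) * INR n)%R).
  { apply Rmult_le_reg_r with (/ (r - Cmod z))%R.
    - apply Rinv_0_lt_compat; unfold r; lra.
    - apply Rle_trans with (INR n); [unfold Rdiv in HN; lra|].
      right. field. unfold r; lra. }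
  assert (H2 : (Cmod (alpha + INR n) <= Cmod alpha + INR n)%R).
  { apply Rle_trans with (1 := Cmod_triangle _ _).
    rewrite Cmod_R, Rabs_pos_eq by apply pos_INR. lra. }
  rewrite S_INR.
  apply Rle_trans with ((Cmod alpha + INR n) * Cmod z)%R; [now apply Rmult_le_compat_r|].
  assert (Cmod alpha * Cmod z <= Cmod alpha * 1)%R by (apply Rmult_le_compat_l; lra).
  assert (0 < r)%R by (unfold r; lra).
  nra.
Qed.

Lemma acos_div_sqrt (u v : R) :
  (0 < u)%R -> acos (u / sqrt (u ^ 2 + v ^ 2)) = atan (Rabs v / u).
Proof.
  intros Hu.
  assert (Hm : (0 < u ^ 2 + v ^ 2)%R) by nra.
  assert (Hs := sqrt_lt_R0 _ Hm).
  rewrite acos_atan by (now apply Rdiv_lt_0_compat).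
  f_equal.
  replace (1 - (u / sqrt (u ^ 2 + v ^ 2))²)%R with ((v / sqrt (u ^ 2 + v ^ 2))²)%R.
  - rewrite sqrt_Rsqr_abs. unfold Rdiv. rewrite Rabs_mult, (Rabs_pos_eq (/ _)).
    + field. split; lra.
    + left. now apply Rinv_0_lt_compat.
  - rewrite !Rsqr_div', Rsqr_sqrt by lra. unfold Rsqr. field. lra.
Qed.

(** Replaces the case distinction in [Carg] by a formula that is differentiable across the real
    axis. It applies to 1 - s z for s in [0,1], whose real part is positive when |z| < 1. *)
Lemma Cln_right_half_plane (w : C) :
  (0 < Re w)%R -> Cln w = (ln (Re w ^ 2 + Im w ^ 2) / 2, atan (Im w / Re w))%R.
Proof.
  destruct w as [u v]. simpl Re. simpl Im. intros Hu. unfold Cln.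
  assert (Hm : (0 < u ^ 2 + v ^ 2)%R) by nra.
  f_equal.
  - unfold Cmod. simpl fst. simpl snd.
    rewrite <- (sqrt_sqrt (u ^ 2 + v ^ 2)) at 2 by lra.
    assert (Hs := sqrt_lt_R0 _ Hm).
    rewrite ln_mult by auto. field.
  - unfold Carg, Cmod. simpl fst. simpl snd. rewrite acos_div_sqrt by auto.
    destruct (Rle_dec 0 v) as [Hv|Hv].
    + now rewrite Rabs_pos_eq.
    + rewrite Rabs_left, Rdiv_opp_l, atan_opp by lra. ring.
Qed.

(** The powers of z sit inside [U], leaving a real variable. The radius of convergence is at least
    1/r > 1, so s = 1 is an interior point: no Abel limit is needed and the derivatives at both ends
    of [0,1] are two-sided. *)
Lemma is_series_PSeries_C (U : nat -> C) (K r s : R) :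
  (0 < r < 1)%R -> (forall n, (Cmod (U n) <= K * r ^ n)%R) -> (0 <= s <= 1)%R ->
  let P := PSeries (fun n => Re (U n)) in
  let Q := PSeries (fun n => Im (U n)) in
  ex_derive P s /\ ex_derive Q s /\
  is_series (fun n => U n * RtoC (s ^ n)) (P s, Q s) /\
  is_series (fun n => RtoC (INR (S n)) * U (S n) * RtoC (s ^ n)) (Derive P s, Derive Q s).
Proof.
  intros Hr HU Hs P Q.
  assert (Rad : forall u : nat -> R, (forall n, (Rabs (u n) <= K * r ^ n)%R) ->
                  Rbar_lt (Rabs s) (CV_radius u)).
  { intros u Hu. apply Rbar_lt_le_trans with (Finite (/ r)).
    - simpl. rewrite Rabs_pos_eq by lra. apply Rle_lt_trans with 1%R; [lra|].
      rewrite <- Rinv_1. apply Rinv_lt_contravar; lra.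
    - apply (proj1 (CV_radius_bounded u)). exists K. intros n.
      rewrite Rabs_mult, (Rabs_pos_eq ((/ r) ^ n)) by
        (apply pow_le; left; apply Rinv_0_lt_compat; lra).
      apply Rle_trans with (K * r ^ n * (/ r) ^ n)%R.
      + apply Rmult_le_compat_r; auto. apply pow_le; left; apply Rinv_0_lt_compat; lra.
      + right. rewrite Rmult_assoc, <- Rpow_mult_distr, Rinv_r, pow1 by lra. ring. }
  assert (R1 : Rbar_lt (Rabs s) (CV_radius (fun n => Re (U n)))).
  { apply Rad. intros n. apply Rle_trans with (2 := HU n).
    apply Rle_trans with (2 := Rmax_Cmod _). apply Rmax_l. }
  assert (R2 : Rbar_lt (Rabs s) (CV_radius (fun n => Im (U n)))).
  { apply Rad. intros n. apply Rle_trans with (2 := HU n).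
    apply Rle_trans with (2 := Rmax_Cmod _). apply Rmax_r. }
  assert (Ser : forall u : nat -> R, Rbar_lt (Rabs s) (CV_radius u) ->
    is_series (fun n => (u n * s ^ n)%R) (PSeries u s)).
  { intros u Hu. apply Series_correct, ex_pseries_R, CV_radius_inside, Hu. }
  split; [|split; [|split]].
  - eexists. apply is_derive_PSeries, R1.
  - eexists. apply is_derive_PSeries, R2.
  - apply is_series_Re_Im.
    + apply is_series_ext with (2 := Ser _ R1). intros n.
      change (Re (U n) * s ^ n = Re (U n) * s ^ n - Im (U n) * 0)%R. ring.
    + apply is_series_ext with (2 := Ser _ R2). intros n.
      change (Im (U n) * s ^ n = Re (U n) * 0 + Im (U n) * s ^ n)%R. ring.
  - unfold P, Q. rewrite !Derive_PSeries by auto.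
    rewrite <- CV_radius_derive in R1, R2.
    apply is_series_Re_Im.
    + apply is_series_ext with (2 := Ser _ R1). intros n.
      rewrite <- Cmult_assoc, <- (Cmult_comm (RtoC (s ^ n))), Cmult_assoc, <- RtoC_mult.
      change (INR (S n) * Re (U (S n)) * s ^ n
              = INR (S n) * s ^ n * Re (U (S n)) - 0 * Im (U (S n)))%R. ring.
    + apply is_series_ext with (2 := Ser _ R2). intros n.
      rewrite <- Cmult_assoc, <- (Cmult_comm (RtoC (s ^ n))), Cmult_assoc, <- RtoC_mult.
      change (INR (S n) * Im (U (S n)) * s ^ n
              = INR (S n) * s ^ n * Im (U (S n)) + 0 * Re (U (S n)))%R. ring.
Qed.

Lemma Cexp_neq_0 (z : C) : Cexp z <> 0.
Proof.
  destruct z as [x y]. unfold Cexp; simpl. intros E. injection E; intros E1 E2.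
  assert (H := exp_pos x). generalize (sin2_cos2 y). unfold Rsqr.
  apply Rmult_integral in E1. apply Rmult_integral in E2.
  destruct E1 as [E1|E1]; [lra|]. destruct E2 as [E2|E2]; [lra|].
  rewrite E1, E2. lra.
Qed.

Lemma Re_pos_one_minus (z : C) (s : R) :
  (Cmod z < 1)%R -> (0 <= s <= 1)%R -> (0 < 1 - s * Re z)%R.
Proof.
  intros Hz Hs. assert (Rabs (Re z) <= Cmod z)%R by apply re_le_Cmod.
  assert (Re z < 1)%R by (generalize (Rle_abs (Re z)); lra).
  destruct (Rle_dec (Re z) 0); nra.
Qed.

(* The two functions are the components of (P + i Q) exp (A + i B). *)
Lemma is_derive_Cexp_mult (A B P Q : R -> R) (s A' B' : R) :
  is_derive A s A' -> is_derive B s B' -> ex_derive P s -> ex_derive Q s ->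
  Derive P s = (- (A' * P s - B' * Q s))%R ->
  Derive Q s = (- (A' * Q s + B' * P s))%R ->
  is_derive (fun s => exp (A s) * (P s * cos (B s) - Q s * sin (B s)))%R s 0%R /\
  is_derive (fun s => exp (A s) * (P s * sin (B s) + Q s * cos (B s)))%R s 0%R.
Proof.
  intros DA DB DP DQ EP EQ.
  split; (auto_derive;
    [repeat split; auto; eexists; eauto
    |change (fun x : R => A x) with A; change (fun x : R => B x) with B;
     change (fun x : R => P x) with P; change (fun x : R => Q x) with Q;
     rewrite (is_derive_unique _ _ _ DA), (is_derive_unique _ _ _ DB), EP, EQ; ring]).
Qed.

(* With f(s) the sum of the series at [s z], s in [0,1], the coefficient recursion gives
   (1 - s z) f'(s) = alpha z f(s), hence f(s) exp (alpha Ln (1 - s z)) is constant. *)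
Lemma binomial_series (alpha z : C) :
  (Cmod z < 1)%R ->
  is_series (fun j => gbinom (alpha + INR j - 1) j * z ^ j) (/ Cpower (1 - z) alpha).
Proof.
  intros Hz.
  destruct (gbinom_growth alpha z Hz) as (K & r & HK & Hr & HU).
  set (U := fun j => gbinom (alpha + INR j - 1) j * z ^ j) in *.
  set (P := PSeries (fun n => Re (U n))). set (Q := PSeries (fun n => Im (U n))).
  set (x := Re z). set (y := Im z). set (p := Re alpha). set (m := Im alpha).
  (* On [0,1], l + i th is Ln (1 - s z), and A + i B is alpha times it. *)
  set (l := fun s : R => (ln ((1 - s * x) ^ 2 + (s * y) ^ 2) / 2)%R).
  set (th := fun s : R => atan (- (s * y) / (1 - s * x))).
  set (A := fun s => (p * l s - m * th s)%R).
  set (B := fun s => (p * th s + m * l s)%R).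
  assert (Hx : forall s, (0 <= s <= 1)%R -> (0 < 1 - s * x)%R)
    by (intros s Hs; now apply Re_pos_one_minus).
  assert (Ode : forall s, (0 <= s <= 1)%R ->
    ((1 : C) - RtoC s * z) * (Derive P s, Derive Q s) = alpha * z * (P s, Q s)).
  { intros s Hs. destruct (is_series_PSeries_C U K r s Hr HU Hs) as (_ & _ & S1 & S2).
    fold P Q in S1, S2.
    set (D := (Derive P s, Derive Q s) : C) in *. set (G := (P s, Q s) : C) in *.
    assert (S3 : is_series (fun n => RtoC (INR n) * U n * RtoC (s ^ n)) (RtoC s * D)).
    { apply is_series_Cof_tail1; [simpl; ring|].
      eapply is_series_Cext; [|apply is_series_Cscal, S2].
      intros n. cbv beta. rewrite <- tech_pow_Rmult, RtoC_mult. ring. }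
    assert (S4 := is_series_Cplus _ _ _ _ (is_series_Cscal (alpha * z) _ _ S1)
                    (is_series_Cscal z _ _ S3)).
    (* Termwise this is (n+1) U_(n+1) = (alpha + n) z U_n; the part with n U_n reassembles to s
       times the derivative. *)
    assert (E : D = alpha * z * G + z * (RtoC s * D)).
    { apply is_series_C_unique with (1 := S2), is_series_Cext with (2 := S4).
      intros n. unfold U.
      transitivity ((alpha + INR n) * gbinom (alpha + INR n - 1) n * z * z ^ n * RtoC (s ^ n)).
      - ring.
      - rewrite <- gbinom_step, Cpow_S. ring. }
    transitivity (D - z * (RtoC s * D)); [ring|].
    rewrite E at 1. ring. }
  set (hr := fun s => (exp (A s) * (P s * cos (B s) - Q s * sin (B s)))%R).
  set (hi := fun s => (exp (A s) * (P s * sin (B s) + Q s * cos (B s)))%R).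
  assert (Der : forall s, (0 <= s <= 1)%R -> is_derive hr s 0%R /\ is_derive hi s 0%R).
  { intros s Hs. specialize (Ode s Hs). specialize (Hx s Hs).
    destruct (is_series_PSeries_C U K r s Hr HU Hs) as (DP & DQ & _).
    fold P Q in DP, DQ.
    set (n2 := ((1 - s * x) ^ 2 + (s * y) ^ 2)%R).
    assert (Hn : (0 < n2)%R) by (unfold n2; nra).
    (* Real and imaginary parts of -z / (1 - s z), with denominator n2 = |1 - s z|^2. *)
    set (l' := ((- x * (1 - s * x) + s * y * y) / n2)%R).
    set (th' := (- y / n2)%R).
    assert (Dl : is_derive l s l').
    { unfold l. auto_derive; [unfold n2 in Hn; simpl in Hn; lra|].
      unfold l', n2 in *. field. lra. }
    assert (Dth : is_derive th s th').
    { unfold th. auto_derive; [lra|]. unfold th', n2 in *. field. lra. }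
    assert (DA : is_derive A s (p * l' - m * th')%R).
    { apply (is_derive_minus (K := R_AbsRing) (V := R_NormedModule)
               (fun s => p * l s)%R (fun s => m * th s)%R); now apply is_derive_scal. }
    assert (DB : is_derive B s (p * th' + m * l')%R).
    { apply (is_derive_plus (K := R_AbsRing) (V := R_NormedModule)
               (fun s => p * th s)%R (fun s => m * l s)%R); now apply is_derive_scal. }
    assert (E1 : ((1 - s * x) * Derive P s + s * y * Derive Q s
                  = (p * x - m * y) * P s - (p * y + m * x) * Q s)%R).
    { apply (f_equal Re) in Ode. revert Ode. unfold x, y, p, m.
      destruct z, alpha. unfold Re, Im; simpl. lra. }
    assert (E2 : ((1 - s * x) * Derive Q s - s * y * Derive P s
                  = (p * x - m * y) * Q s + (p * y + m * x) * P s)%R).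
    { apply (f_equal Im) in Ode. revert Ode. unfold x, y, p, m.
      destruct z, alpha. unfold Re, Im; simpl. lra. }
    (* Solves [E1] and [E2] for the derivatives, that is, multiplies by the conjugate of 1 - s z and
       divides by [n2]. *)
    assert (F1 : (Derive P s = - ((p * l' - m * th') * P s - (p * th' + m * l') * Q s))%R).
    { transitivity (((1 - s * x) * ((1 - s * x) * Derive P s + s * y * Derive Q s)
         - s * y * ((1 - s * x) * Derive Q s - s * y * Derive P s)) / n2)%R.
      - unfold n2 in *. field. lra.
      - rewrite E1, E2. unfold l', th'. unfold n2 in *. field. lra. }
    assert (F2 : (Derive Q s = - ((p * l' - m * th') * Q s + (p * th' + m * l') * P s))%R).
    { transitivity (((1 - s * x) * ((1 - s * x) * Derive Q s - s * y * Derive P s)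
         + s * y * ((1 - s * x) * Derive P s + s * y * Derive Q s)) / n2)%R.
      - unfold n2 in *. field. lra.
      - rewrite E1, E2. unfold l', th'. unfold n2 in *. field. lra. }
    now apply is_derive_Cexp_mult with (p * l' - m * th')%R (p * th' + m * l')%R. }
  assert (Hr1 : hr 0%R = hr 1%R) by (apply eq_is_derive; [apply Der|lra]).
  assert (Hi1 : hi 0%R = hi 1%R) by (apply eq_is_derive; [apply Der|lra]).
  assert (L0 : l 0%R = 0%R).
  { unfold l. replace ((1 - 0 * x) ^ 2 + (0 * y) ^ 2)%R with 1%R by ring.
    rewrite ln_1. field. }
  assert (T0 : th 0%R = 0%R).
  { unfold th. replace (- (0 * y) / (1 - 0 * x))%R with 0%R by (field; lra). apply atan_0. }
  assert (U0 : U O = 1) by (unfold U, gbinom; simpl; field).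
  assert (P0 : P 0%R = 1%R) by (unfold P; rewrite PSeries_0, U0; reflexivity).
  assert (Q0 : Q 0%R = 0%R) by (unfold Q; rewrite PSeries_0, U0; reflexivity).
  assert (A0 : A 0%R = 0%R) by (unfold A; rewrite L0, T0; ring).
  assert (B0 : B 0%R = 0%R) by (unfold B; rewrite L0, T0; ring).
  assert (Pw : Cpower (1 - z) alpha = Cexp (A 1%R, B 1%R)).
  { unfold Cpower. rewrite Cln_right_half_plane.
    - f_equal. unfold A, B, l, th, p, m, x, y. destruct z as [x' y'], alpha as [p' m'].
      unfold Re, Im, Cmult; simpl.
      replace (- (1 * y') / (1 - 1 * x'))%R with ((0 + - y') / (1 + - x'))%R.
      2:{ f_equal; ring. }
      f_equal; f_equal; repeat (f_equal; try ring).
    - specialize (Hx 1%R ltac:(lra)). unfold x in Hx. destruct z; unfold Re in *; simpl in *; lra. }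
  assert (G : ((P 1%R, Q 1%R) : C) * Cexp (A 1%R, B 1%R) = 1).
  { unfold Cexp, Cmult; simpl.
    replace (P 1%R * (exp (A 1%R) * cos (B 1%R)) - Q 1%R * (exp (A 1%R) * sin (B 1%R)))%R
      with (hr 1%R) by (unfold hr; ring).
    replace (P 1%R * (exp (A 1%R) * sin (B 1%R)) + Q 1%R * (exp (A 1%R) * cos (B 1%R)))%R
      with (hi 1%R) by (unfold hi; ring).
    rewrite <- Hr1, <- Hi1. unfold hr, hi.
    rewrite A0, B0, P0, Q0, exp_0, cos_0, sin_0. apply injective_projections; simpl; ring. }
  destruct (is_series_PSeries_C U K r 1 Hr HU ltac:(lra)) as (_ & _ & S1 & _).
  fold P Q in S1.
  replace (/ Cpower (1 - z) alpha) with ((P 1%R, Q 1%R) : C).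
  - apply is_series_Cext with (2 := S1). intros n. rewrite pow1. unfold U. ring.
  - rewrite Pw. assert (N := Cexp_neq_0 (A 1%R, B 1%R)).
    set (w := (P 1%R, Q 1%R) : C) in *. change (w = / Cexp (A 1%R, B 1%R)).
    transitivity (w * Cexp (A 1%R, B 1%R) * / Cexp (A 1%R, B 1%R)).
    + now field.
    + rewrite G. ring.
Qed.

(** * Interchange of the double sum *)

Theorem theorem2p2 (q a b c d alpha : C)
    (hq : (Cmod q < 1)%R) (ha : (Cmod a < 1)%R) (hc : (Cmod c < 1)%R)
    (ha0 : a <> 0) (hb0 : b <> 0)
    (hd : forall n : nat, qpoch q d n <> 0) :
  exists (S : C) (T : nat -> C),
    is_series
      (fun n : nat =>
         qpoch q (b / a) n * a ^ n
         / (Cpower (1 - c * q ^ n) alpha * qpoch q d n)) S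
    /\ (forall j : nat,
          is_series
            (fun n : nat =>
               qpoch q (a * d / b) n * (- b) ^ n * q ^ (n * (n - 1) / 2 + j * n)
               / (qpoch q d n * qpoch q (a * q ^ j) (n + 1))) (T j))
    /\ is_series
         (fun j : nat => c ^ j * gbinom (alpha + INR j - 1) j * T j) S.
Proof.
  assert (hba : b / a <> 0).
  { apply Cmult_neq_0; auto. intros E. apply C1_nz.
    transitivity (a * / a); [now field|rewrite E; ring]. }
  destruct (fine_term_growth q (b / a) d a hq ha hd) as (rho & K & r & _ & HK & Hr & HG).
  destruct (gbinom_growth alpha c hc) as (K' & r' & HK' & Hr' & HG').
  set (u := fine_term q (b / a) d a).
  set (w := fun j => gbinom (alpha + INR j - 1) j * c ^ j) in *.
  set (F := fun j => Cseries (fine_term q (b / a) d (a * q ^ j))).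
  assert (Bu : forall n, (Cmod (u n) <= K * r ^ n)%R).
  { intros n. specialize (HG O n). simpl in HG. rewrite !Cmult_1_r in HG.
    rewrite Rmult_1_r in HG. fold u in HG.
    now replace (u n / 1) with (u n) in HG by field. }
  assert (Bq : forall n j, (Cmod ((q ^ j) ^ n) <= 1)%R).
  { intros n j. rewrite <- Cpow_mult_r, Cmod_pow, <- (pow1 (j * n)).
    apply pow_incr. split; [apply Cmod_ge_0|lra]. }
  assert (SF : forall j, is_series (fine_term q (b / a) d (a * q ^ j)) (F j)).
  { intros j. apply is_series_Cseries with (fun n => (K * r ^ n)%R).
    2: now apply ex_series_geometric_bound.
    intros n. unfold fine_term. rewrite Cpow_mult_l.
    replace (qpoch q (b / a) n * (a ^ n * (q ^ j) ^ n) / qpoch q d n) with (u n * (q ^ j) ^ n)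
      by (unfold u, fine_term; field; apply hd).
    rewrite Cmod_mult. specialize (Bu n). specialize (Bq n j).
    assert (H := Cmod_ge_0 (u n)). assert (H' := Cmod_ge_0 ((q ^ j) ^ n)). nra. }
  destruct (ex_series_geometric_bound K r Hr) as [X HX].
  (* Row n, summed over j, is the binomial series at c q^n; column j, summed over n, is [w j] times
     F(d, a q^j), since (q^j)^n merges with a^n. *)
  destruct (is_series_switch (fun n j => u n * (w j * (q ^ j) ^ n))
     (fun n => K * r ^ n)%R (fun j => K' * r' ^ j)%R X
     (fun n => u n * / Cpower (1 - c * q ^ n) alpha) (fun j => w j * F j)) as [S1 S2].
  - intros n j. rewrite !Cmod_mult.
    apply Rmult_le_compat; auto using Cmod_ge_0.
    + apply Rmult_le_pos; apply Cmod_ge_0.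
    + rewrite <- (Rmult_1_r (K' * r' ^ j)).
      apply Rmult_le_compat; auto using Cmod_ge_0. apply HG'.
  - intros n. apply Rmult_le_pos; auto. apply pow_le; lra.
  - exact HX.
  - apply ex_series_geometric_bound; lra.
  - intros n. apply is_series_Cscal.
    apply is_series_Cext with (2 := binomial_series alpha _ (Cmod_mul_pow_lt q c n hq hc)).
    intros j. unfold w. rewrite Cpow_mult_l, <- !Cpow_mult_r, (Nat.mul_comm n j). ring.
  - intros j. apply is_series_Cext with (2 := is_series_Cscal (w j) _ _ (SF j)).
    intros n. unfold u, fine_term. rewrite Cpow_mult_l. field. apply hd.
  - eexists; exists F. split; [|split].
    + apply is_series_Cext with (2 := S1). intros n. unfold u, fine_term.
      field. split; [apply hd|apply Cexp_neq_0].
    + intros j.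
      apply is_series_Cext with (2 := fine_transformation q (b / a) d (a * q ^ j) (F j)
                     hq (Cmod_mul_pow_lt q a j hq ha) hba hd (SF j)).
      intros n. unfold fine_dual_term.
      replace (d / (b / a)) with (a * d / b) by (field; auto).
      replace (- (b / a * (a * q ^ j))) with (- b * q ^ j) by (field; auto).
      rewrite Cpow_mult_l, Cpow_add_r, Cpow_mult_r. unfold Cdiv. ring.
    + apply is_series_Cext with (2 := S2). intros j. unfold w. ring.
Qed.
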